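(* Let $n\geq 5$ and $x,y,z,a>0$, and suppose $x\leq\min\{a,y,z\}$. If none of the following holds: (i) $x<z<a<y$ and $z<1$; (ii) $x<y<a<z$ and $1<a$; (iii) $x\leq a<1<\min\{y,z\}$, then the Perron eigenvector of $Z_n(x,y,z,a)$ is efficient for $Z_n(x,y,z,a)$.
   Context: $Z_n(x,y,z,a)$ is the $n\times n$ matrix all of whose entries equal $1$ except: entry $(1,n-1)=y$, $(1,n)=x$, $(2,n-1)=a$, $(2,n)=z$, and $(n-1,1)=1/y$, $(n,1)=1/x$, $(n-1,2)=1/a$, $(n,2)=1/z$. It is a reciprocal matrix (positive entries with $a_{ij}=1/a_{ji}$). The Perron eigenvector is the positive eigenvector associated with the largest eigenvalue, normalized to have first component $1$. A positive vector $w$ is efficient for a reciprocal matrix $A=[a_{ij}]$ if there is no other positive vector $w'$ with $|a_{ij}-w'_i/w'_j|\leq|a_{ij}-w_i/w_j|$ for all $i,j$ with strict inequality for at least one pair $(i,j)$. *)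

(* Defs.v *)
From HB Require Import structures.
From mathcomp Require Import all_boot all_order all_algebra.
From mathcomp Require Import complex reals.

Set Implicit Arguments.
Unset Strict Implicit.
Unset Printing Implicit Defensive.

Import Order.TTheory GRing.Theory Num.Theory.
Local Open Scope ring_scope.

(* Ordinals are 0-based, hence the successors: [i.+1] and [j.+1] are the
   usual 1-based row and column numbers. *)
Definition Zmx (R : realType) (n : nat) (x y z a : R) : 'M[R]_n :=
  \matrix_(i < n, j < n)
    if (i.+1, j.+1) == (1, n - 1)%N then y
    else if (i.+1, j.+1) == (1, n)%N then x
    else if (i.+1, j.+1) == (2, n - 1)%N then a
    else if (i.+1, j.+1) == (2, n)%N then z
    else if (i.+1, j.+1) == (n - 1, 1)%N then y^-1
    else if (i.+1, j.+1) == (n, 1)%N then x^-1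
    else if (i.+1, j.+1) == (n - 1, 2)%N then a^-1
    else if (i.+1, j.+1) == (n, 2)%N then z^-1
    else 1.

Definition positive_vec (R : realType) (n : nat) (w : 'cV[R]_n) : Prop :=
  forall i, 0 < w i 0.

(* The eigenvalues of a real matrix are complex numbers, so "largest" is meant
   in modulus. [eigenvalue] is defined by row eigenvectors, but a square matrix
   and its transpose have the same eigenvalues. *)
Definition largest_eigenvalue (R : realType) (n : nat) (A : 'M[R]_n) (r : R) :
    Prop :=
  eigenvalue A r /\
  forall mu : R[i],
    eigenvalue (map_mx (real_complex R) A) mu -> `|mu| <= real_complex R r.

Definition is_perron_eigenvector (R : realType) (n : nat) (A : 'M[R]_n)
    (w : 'cV[R]_n) : Prop :=
  [/\ positive_vec w,
      exists2 r : R, largest_eigenvalue A r & A *m w = r *: w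
    & forall i : 'I_n, i = 0%N :> nat -> w i 0 = 1].

Definition efficient (R : realType) (n : nat) (A : 'M[R]_n) (w : 'cV[R]_n) :
    Prop :=
  positive_vec w /\
  ~ exists w' : 'cV[R]_n,
      [/\ positive_vec w',
          forall i j, `|A i j - w' i 0 / w' j 0| <= `|A i j - w i 0 / w j 0|
        & exists i j, `|A i j - w' i 0 / w' j 0| < `|A i j - w i 0 / w j 0|].

(* Main.v *)
(* If w is not efficient, the indices minimizing w'_i / w_i for a dominating w'
   form a proper nonempty set U with w_i / w_j > a_ij whenever i is in U and j
   is not (say "i beats j").  Since the Perron root r is at least n, row i of
   A w = r w shows that every i in U is beaten by some member of U, so U
   contains a cycle of beats.  The middle indices 3, ..., n-2 have equal
   weights, so U is a union of the classes {1}, {2}, {3, ..., n-2}, {n-1}, {n}.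
   The eigenvector equations exclude the sets U made of at most three classes.
   If U misses exactly one class, they contradict the minimality of x when it is
   {1} or {n}, and force (i) for {2}, (ii) for {n-1}, (iii) for the middle. *)

Require Import Defs.
From HB Require Import structures.
From mathcomp Require Import all_boot all_order all_algebra.
From mathcomp Require Import complex reals.
From mathcomp Require Import ring lra zify.

Set Implicit Arguments.
Unset Strict Implicit.
Unset Printing Implicit Defensive.

Import Order.TTheory GRing.Theory Num.Theory.
Local Open Scope ring_scope.

(** * The eigenvector equations and their symmetries *)

(* The eigenvector equations for Zmx, with weights u, v, c, s, t at the indices
   1, 2, middle, n-1, n, and M the sum of the weights of all middle indices. *)
Record Zsystem (R : realFieldType) (x y z a u v c s t M r : R) : Prop :=
    ZSystem {
  Zx : 0 < x; Zy : 0 < y; Zz : 0 < z; Za : 0 < a;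
  Zu : 0 < u; Zv : 0 < v; Zc : 0 < c; Zs : 0 < s; Zt : 0 < t;
  ZM : 0 < M; Zr : 0 < r;
  Z1 : r * u = u + v + M + y * s + x * t;
  Z2 : r * v = u + v + M + a * s + z * t;
  Zm : r * c = u + v + M + s + t;
  Zp : r * s = s + t + M + y^-1 * u + a^-1 * v;
  Zq : r * t = s + t + M + x^-1 * u + z^-1 * v
}.

Lemma Zsystem_swap_rows (R : realFieldType) (x y z a u v c s t M r : R) :
  Zsystem x y z a u v c s t M r -> Zsystem z a x y v u c s t M r.
Proof. by case=> *; split=> //; lra. Qed.

Lemma Zsystem_swap_cols (R : realFieldType) (x y z a u v c s t M r : R) :
  Zsystem x y z a u v c s t M r -> Zsystem y x a z u v c t s M r.
Proof. by case=> *; split=> //; lra. Qed.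

(* Reversing the order of the indices. *)
Lemma Zsystem_dual (R : realFieldType) (x y z a u v c s t M r : R) :
  Zsystem x y z a u v c s t M r ->
  Zsystem x^-1 z^-1 y^-1 a^-1 t s c v u M r.
Proof. by case=> *; split; rewrite ?invr_gt0 ?invrK //; lra. Qed.

Lemma ltr_mulVl (R : realFieldType) (x u t : R) :
  0 < x -> (t < x^-1 * u) = (x * t < u).
Proof. by move=> x0; rewrite ltr_pdivlMl. Qed.

Lemma gtr_mulVl (R : realFieldType) (x u t : R) :
  0 < x -> (x^-1 * u < t) = (u < x * t).
Proof. by move=> x0; rewrite ltr_pdivrMl. Qed.

(** * Configurations excluded by the eigenvector equations *)

(* Here [n] and the middle beat [1].  The symmetries above give the analogous
   statement for every corner entry. *)
Lemma corner_not_min (R : realFieldType) (x y z a u v c s t M r : R) :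
  Zsystem x y z a u v c s t M r ->
  u < c -> u < x * t -> x <= y -> x <= z -> False.
Proof.
case=> x0 y0 z0 a0 u0 v0 c0 s0 t0 M0 r0 e1 e2 em ep eq uc uxt xy xz.
have X'E : x * (x^-1 * u) = u by rewrite mulVKf ?gt_eqF.
have Z'E : z * (z^-1 * v) = v by rewrite mulVKf ?gt_eqF.
have Z'0 : 0 < z^-1 * v by rewrite mulr_gt0 ?invr_gt0.
move: eq X'E Z'E Z'0; set X' := _ * u; set Z' := _ * v => eq X'E Z'E Z'0.
have x1 : x < 1.
  have h1 : r * u < r * c by rewrite ltr_pM2l.
  have h2 : x * s <= y * s by rewrite ler_pM2r.
  have h3 : x * (s + t) < 1 * (s + t) by lra.
  by rewrite ltr_pM2r in h3; lra.
(* Row n times x is at most u + v + x (s + t + M), which [x1] and x <= y put below row 1. So r x t <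
   r u, against u < x t. *)
have h1 : 0 < r * (x * t - u) by rewrite mulr_gt0 // subr_gt0.
have h2 : 0 <= (y - x) * s by rewrite mulr_ge0 ?subr_ge0 // ltW.
have h3 : 0 <= (z - x) * Z' by rewrite mulr_ge0 ?subr_ge0 // ltW.
have h4 : 0 < (1 - x) * M by rewrite mulr_gt0 // subr_gt0.
have h5 : x * (r * t) = x * (s + t + M + X' + Z') by rewrite eq.
lra.
Qed.

(* The set {2, middle, n}, with [2] beating [n] and [n] beating the middle. *)
Lemma no_source_2mq (R : realFieldType) (x y z a u v c s t M r : R) :
  Zsystem x y z a u v c s t M r ->
  u < v -> u < c -> s < c -> s < t -> c < t ->
  u < x * t -> a * s < v -> z * t < v -> False.
Proof.
case=> x0 y0 z0 a0 u0 v0 c0 s0 t0 M0 r0 e1 e2 em ep eq uv uc sc st ct uX Av Zv.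
have Y'E : y * (y^-1 * u) = u by rewrite mulVKf ?gt_eqF.
have A'E : a * (a^-1 * v) = v by rewrite mulVKf ?gt_eqF.
have A's : s < a^-1 * v by rewrite ltr_mulVl.
have Y's : (s < y^-1 * u) = (y * s < u) by rewrite ltr_mulVl.
move: ep Y'E A'E A's Y's; set Y' := _ * u; set A' := _ * v.
move=> ep Y'E A'E A's Y's.
(* Otherwise row 1 divided by u and row 2 divided by v give r > 2 + (u + v + M) / u and r < 2 + (u +
   v + M) / v, against u < v. *)
have Yu : y * s < u.
  rewrite ltNge; apply/negP => uY.
  have k0 : v * (r * u) = v * (u + v + M + y * s + x * t) by rewrite e1.
  have k1 : u * (r * v) = u * (u + v + M + a * s + z * t) by rewrite e2.
  have h1 : 0 <= v * (y * s - u) by rewrite mulr_ge0 ?subr_ge0 // ltW.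
  have h2 : 0 < v * (x * t - u) by rewrite mulr_gt0 ?subr_gt0.
  have h3 : 0 < u * (v - a * s) by rewrite mulr_gt0 ?subr_gt0.
  have h4 : 0 < u * (v - z * t) by rewrite mulr_gt0 ?subr_gt0.
  have h5 : 0 < (v - u) * (u + v + M).
    by rewrite mulr_gt0 ?subr_gt0 ?addr_gt0.
  lra.
have {}Y's : s < Y' by rewrite Y's.
(* If s <= v, rows n-1 and 2 give 3 + (t + M) / s < r < 3 + (u + M) / v, although u < c < t. *)
have vs : v < s.
  rewrite ltNge; apply/negP => sv.
  have k0 : s * (r * v) = s * (u + v + M + a * s + z * t) by rewrite e2.
  have k1 : v * (r * s) = v * (s + t + M + Y' + A') by rewrite ep.
  have h1 : 0 < s * (v - a * s) by rewrite mulr_gt0 ?subr_gt0.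
  have h2 : 0 < s * (v - z * t) by rewrite mulr_gt0 ?subr_gt0.
  have h3 : 0 < v * (Y' - s) by rewrite mulr_gt0 ?subr_gt0.
  have h4 : 0 < v * (A' - s) by rewrite mulr_gt0 ?subr_gt0.
  have h5 : 0 <= (v - s) * (t + M).
    by rewrite mulr_ge0 ?subr_ge0 ?addr_ge0 // ltW.
  have h6 : 0 < s * (t - u) by rewrite mulr_gt0 // subr_gt0; lra.
  lra.
have y1 : y < 1.
  have : y * s < 1 * s by lra.
  by rewrite ltr_pM2r.
have a1 : a < 1.
  have : a * s < 1 * s by lra.
  by rewrite ltr_pM2r.
(* Since y, a < 1, Y' + A' > u + v, so row n-1 exceeds the middle row, against s < c. *)
have h1 : 0 < (1 - y) * Y' by rewrite mulr_gt0 ?subr_gt0 //; lra.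
have h2 : 0 < (1 - a) * A' by rewrite mulr_gt0 ?subr_gt0 //; lra.
have h3 : r * s < r * c by rewrite ltr_pM2l.
lra.
Qed.

(* The set {2, n-1, n}, with [n] beating [2] and [2] beating [n-1]. *)
Lemma no_source_2pq (R : realFieldType) (x y z a u v c s t M r : R) :
  Zsystem x y z a u v c s t M r ->
  c < v -> c < t ->
  u < x * t -> u < y * s -> v < z * t -> a * s < v -> False.
Proof.
case=> x0 y0 z0 a0 u0 v0 c0 s0 t0 M0 r0 e1 e2 em ep eq cv ct uX uY vZ Av.
have Z'E : z * (z^-1 * v) = v by rewrite mulVKf ?gt_eqF.
have X't : x^-1 * u < t by rewrite gtr_mulVl.
have Z't : z^-1 * v < t by rewrite gtr_mulVl.
move: eq Z'E X't Z't; set X' := _ * u; set Z' := _ * v => eq Z'E X't Z't.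
(* Multiplying each row by c and inserting the middle row for r c eliminates r. *)
have k1 : u * (r * c) = c * (u + v + M + y * s + x * t) by rewrite -e1; ring.
have k2 : v * (r * c) = c * (u + v + M + a * s + z * t) by rewrite -e2; ring.
have kq : t * (r * c) = c * (s + t + M + X' + Z') by rewrite -eq; ring.
rewrite em in k1 k2 kq.
have tsM : 0 < (t - c) * (s + M) by rewrite mulr_gt0 ?subr_gt0 ?addr_gt0.
have uvt : u + v + t < 3 * c.
  rewrite -(ltr_pM2l t0).
  have h1 : 0 < c * (t - X') by rewrite mulr_gt0 ?subr_gt0.
  have h2 : 0 < c * (t - Z') by rewrite mulr_gt0 ?subr_gt0.
  lra.
have uc : u < c by lra.
have cvus : c * v < u * s.
  have h1 : 0 < c * (y * s - u) by rewrite mulr_gt0 ?subr_gt0.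
  have h2 : 0 < c * (x * t - u) by rewrite mulr_gt0 ?subr_gt0.
  have h3 : 0 < u * (3 * c - (u + v + t)) by rewrite mulr_gt0 ?subr_gt0.
  have h4 : 0 < (c - u) * M by rewrite mulr_gt0 ?subr_gt0.
  lra.
have vscZ : v * s < c * (z * t).
  have h1 : 0 < c * (v - a * s) by rewrite mulr_gt0 ?subr_gt0.
  have h2 : 0 < (v - c) * (u + v + M).
    by rewrite mulr_gt0 ?subr_gt0 ?addr_gt0.
  have h3 : 0 < v * (t - c) by rewrite mulr_gt0 ?subr_gt0.
  lra.
have Z'sct : Z' * s < c * t.
  by rewrite -(ltr_pM2l z0) mulrA Z'E; lra.
have us : s * (u + v + t - 2 * c) < c * c.
  rewrite -(ltr_pM2l t0).
  have h1 : 0 < c * (t - X') by rewrite mulr_gt0 ?subr_gt0.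
  have h2 : t * (u + v + t) < 2 * c * t + c * Z' by lra.
  have h3 : 0 < s * (2 * c * t + c * Z' - t * (u + v + t)).
    by rewrite mulr_gt0 ?subr_gt0.
  have h4 : 0 < c * (c * t - Z' * s) by rewrite mulr_gt0 ?subr_gt0.
  lra.
(* As v + t > 2 c, [us] gives u s < c^2, while [cvus] and c < v give u s > c^2. *)
have h1 : 0 < s * (v + t - 2 * c) by rewrite mulr_gt0 //; lra.
have h2 : 0 < c * (v - c) by rewrite mulr_gt0 ?subr_gt0.
lra.
Qed.

(** * Case analysis on the classes contained in the set *)

(* [b1], [b2], [bm], [bp], [bq] tell whether 1, 2, the middle, n-1, n are in the
   set.  The fields S say that members beat non-members, the fields B that each
   member is beaten by a member. *)
Record Zsource (R : realFieldType) (x y z a u v c s t : R)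
    (b1 b2 bm bp bq : bool) : Prop := ZSource {
  S12 : b1 (+) b2 -> if b1 then v < u else u < v;
  S1m : b1 (+) bm -> if b1 then c < u else u < c;
  S2m : b2 (+) bm -> if b2 then c < v else v < c;
  Spm : bp (+) bm -> if bp then c < s else s < c;
  Sqm : bq (+) bm -> if bq then c < t else t < c;
  Spq : bp (+) bq -> if bp then t < s else s < t;
  S1p : b1 (+) bp -> if b1 then y * s < u else u < y * s;
  S1q : b1 (+) bq -> if b1 then x * t < u else u < x * t;
  S2p : b2 (+) bp -> if b2 then a * s < v else v < a * s;
  S2q : b2 (+) bq -> if b2 then z * t < v else v < z * t;
  B1 : b1 -> [|| b2 && (u < v), bm && (u < c), bp && (u < y * s)
               | bq && (u < x * t)];
  B2 : b2 -> [|| b1 && (v < u), bm && (v < c), bp && (v < a * s)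
               | bq && (v < z * t)];
  Bm : bm -> [|| b1 && (c < u), b2 && (c < v), bp && (c < s) | bq && (c < t)];
  Bp : bp -> [|| b1 && (y * s < u), b2 && (a * s < v), bm && (s < c)
               | bq && (s < t)];
  Bq : bq -> [|| b1 && (x * t < u), b2 && (z * t < v), bm && (t < c)
               | bp && (t < s)]
}.

(** The fields B force a cycle of beats inside the set. With at most two classes, or with {1, 2,
    middle} or {middle, n-1, n}, such a cycle is a circular chain of strict inequalities. The other
    eight triples, each with two orientations of a 3-cycle, are carried by the eight symmetries to
    [no_source_2mq] or [no_source_2pq]. *)
Lemma source_almost_full (R : realFieldType) (x y z a u v c s t M r : R)
    (b1 b2 bm bp bq : bool) :
  Zsystem x y z a u v c s t M r -> Zsource x y z a u v c s t b1 b2 bm bp bq ->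
  [|| b1, b2, bm, bp | bq] -> (4 <= b1 + b2 + bm + bp + bq)%N.
Proof.
move=> e1.
have e2 := Zsystem_swap_rows e1; have e3 := Zsystem_swap_cols e1.
have e4 := Zsystem_swap_cols e2.
have d1 := Zsystem_dual e1; have d2 := Zsystem_dual e2.
have d3 := Zsystem_dual e3; have d4 := Zsystem_dual e4.
have [x0 y0 z0 a0] := And4 (Zx e1) (Zy e1) (Zz e1) (Za e1).
have sgn := (ltr_mulVl, gtr_mulVl).
case=> h1 h2 h3 h4 h5 h6 h7 h8 h9 h10 k1 k2 k3 k4 k5.
have clash (f g : R) : f < g -> g < f -> False.
  by move=> fg /(lt_trans fg); rewrite ltxx.
have cyc (f g h : R) : f < g -> g < h -> h < f -> False.
  by move=> fg /(lt_trans fg); apply: clash.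
case: b1 b2 bm bp bq h1 h2 h3 h4 h5 h6 h7 h8 h9 h10 k1 k2 k3 k4 k5 =>
  [] [] [] [] [] //=;
  move=> h1 h2 h3 h4 h5 h6 h7 h8 h9 h10 k1 k2 k3 k4 k5;
  repeat match goal with H : is_true true -> _ |- _ => specialize (H isT) end;
  repeat match goal with H : is_true false -> _ |- _ => clear H end; exfalso;
  repeat match goal with
  | H : is_true (_ || _) |- _ => case/orP: H => H
  end => //;
  try match goal with
  | H1 : is_true (?f < ?g), H2 : is_true (?g < ?f) |- _ => exact: clash H1 H2
  | H1 : is_true (?f < ?g), H2 : is_true (?g < ?h), H3 : is_true (?h < ?f)
    |- _ =>
    exact: cyc H1 H2 H3
  end.
all: match goal with e : Zsystem _ _ _ _ _ _ _ _ _ _ _ |- _ => first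
 [ by apply: (no_source_2mq e); rewrite ?sgn
 | by apply: (no_source_2pq e); rewrite ?sgn ] end.
Qed.

Lemma source_full (R : realFieldType) (x y z a u v c s t M r : R)
    (b1 b2 bm bp bq : bool) :
  x <= a -> x <= y -> x <= z ->
  ~ (x < z < a /\ a < y /\ z < 1) ->
  ~ (x < y < a /\ a < z /\ 1 < a) ->
  ~ (x <= a /\ a < 1 < Num.min y z) ->
  Zsystem x y z a u v c s t M r -> Zsource x y z a u v c s t b1 b2 bm bp bq ->
  [|| b1, b2, bm, bp | bq] -> [&& b1, b2, bm, bp & bq].
Proof.
move=> xa xy xz hi hii hiii e1 S /(source_almost_full e1 S).
have e2 := Zsystem_swap_rows e1; have e3 := Zsystem_swap_cols e1.
have e4 := Zsystem_swap_cols e2.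
have d2 := Zsystem_dual e2; have d3 := Zsystem_dual e3.
have d4 := Zsystem_dual e4.
case: e1 (e1) => x0 y0 z0 a0 u0 v0 c0 s0 t0 M0 r0 r1 r2 rc rp rq e1.
have row (f g : R) : f < g -> r * f < r * g by rewrite ltr_pM2l.
have inv (e f g : R) :
    0 < e -> 0 < f -> 0 < g -> e <= f -> f^-1 * g <= e^-1 * g.
  by move=> e0 f0 g0 ef; rewrite ler_pM2r // lef_pV2.
have inv1 (e g : R) : 0 < e -> 0 < g -> e <= 1 -> g <= e^-1 * g.
  by move=> e0 g0 /(inv _ _ _ e0 ltr01 g0); rewrite invr1 mul1r.
have inv1' (e g : R) : 0 < e -> 0 < g -> 1 <= e -> e^-1 * g <= g.
  by move=> e0 g0 /(inv _ _ _ ltr01 e0 g0); rewrite invr1 mul1r.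
have mul (e f g : R) : 0 < g -> e <= f -> e * g <= f * g.
  by move=> g0 ef; rewrite ler_pM2r.
have V (e f : R) : 0 < e -> 0 < f -> e <= f -> f^-1 <= e^-1.
  by move=> e0 f0; rewrite lef_pV2.
case: S => h1 h2 h3 h4 h5 h6 h7 h8 h9 h10 _ _ _ _ _.
case: b1 b2 bm bp bq h1 h2 h3 h4 h5 h6 h7 h8 h9 h10 =>
  [] [] [] [] [] //= h1 h2 h3 h4 h5 h6 h7 h8 h9 h10 _; exfalso;
  repeat match goal with H : is_true true -> _ |- _ => specialize (H isT) end;
  repeat match goal with H : is_true false -> _ |- _ => clear H end.
(* The set misses n. If a <= z, the entry 1/z of the dual system violates [corner_not_min]. So z <
   a, and with x <= y this makes row n at least row n-1, against t < s. *)
- have za : z < a.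
    rewrite ltNge; apply/negP => az.
    by apply: (corner_not_min d2); rewrite ?V ?ltr_mulVl.
  have := row _ _ h6; have := inv _ _ _ x0 y0 u0 xy.
  have := inv _ _ _ z0 a0 v0 (ltW za); lra.
(* The set misses n-1. The dual entries 1/y and 1/a give y < a and a < z; comparing row n-1 with row
   n and with the middle row completes (ii). *)
- have ya : y < a.
    rewrite ltNge; apply/negP => ay.
    by apply: (corner_not_min d3); rewrite ?V ?ltr_mulVl.
  have az : a < z.
    rewrite ltNge; apply/negP => az.
    by apply: (corner_not_min d4); rewrite ?V ?ltr_mulVl // ltW.
  apply: hii; split; [apply/andP; split=> // | split=> //].
  + rewrite ltNge; apply/negP => yx.
    have := row _ _ h6; have := inv _ _ _ y0 x0 u0 yx.
    have := inv _ _ _ a0 z0 v0 (ltW az); lra.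
  + rewrite ltNge; apply/negP => a1.
    have := row _ _ h4; have := inv1 _ _ a0 v0 a1.
    have := inv1 _ _ y0 u0 (le_trans (ltW ya) a1); lra.
(* The set misses the middle, whose row is then below the other four. This gives x < 1, 1 < y, a < 1
   and 1 < z in turn, hence (iii). *)
- have := (row _ _ h2, row _ _ h3, row _ _ h4, row _ _ h5).
  case=> [[[]]] k1 k2 k3 k4.
  have x1 : x < 1.
    rewrite ltNge; apply/negP => x1.
    have := inv1' _ _ y0 u0 (le_trans x1 xy).
    have := inv1' _ _ a0 v0 (le_trans x1 xa); lra.
  have y1 : 1 < y.
    rewrite ltNge; apply/negP => y1.
    have := mul _ _ _ s0 y1; have := mul _ _ _ t0 (ltW x1); lra.
  have a1 : a < 1.
    rewrite ltNge; apply/negP => a1.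
    have := inv1' _ _ a0 v0 a1; have := inv1' _ _ y0 u0 (ltW y1); lra.
  have z1 : 1 < z.
    rewrite ltNge; apply/negP => z1.
    have := mul _ _ _ s0 (ltW a1); have := mul _ _ _ t0 z1; lra.
  by apply: hiii; rewrite a1 lt_min y1 z1.
(* The set misses 2. The entries a and z give z < a and x < z; comparing row 2 with row 1 and with
   the middle row completes (i). *)
- have za : z < a.
    rewrite ltNge; apply/negP => az.
    apply: (corner_not_min e4) => //.
    rewrite leNgt; apply/negP => ya.
    have := row _ _ h1; have := mul _ _ _ s0 (ltW ya).
    have := mul _ _ _ t0 xz; lra.
  have xz' : x < z.
    rewrite ltNge; apply/negP => zx.
    by apply: (corner_not_min e2) => //; rewrite ltW.
  apply: hi; split; [exact/andP | split].
  + rewrite ltNge; apply/negP => ya.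
    have := row _ _ h1; have := mul _ _ _ s0 ya; have := mul _ _ _ t0 xz; lra.
  + rewrite ltNge; apply/negP => z1.
    have := row _ _ h3; have := mul _ _ _ s0 (le_trans z1 (ltW za)).
    have := mul _ _ _ t0 z1; lra.
(* The set misses 1. *)
- exact: (corner_not_min e1).
Qed.

(** * Efficiency and positive eigenvectors of reciprocal matrices *)

Lemma efficient_of_no_source (R : realType) (n : nat) (A : 'M[R]_n)
    (w : 'cV[R]_n) :
  (forall i j, 0 < A i j) -> (forall i j, A j i = (A i j)^-1) ->
  positive_vec w ->
  (forall U : {set 'I_n}, U != set0 ->
     (forall i j, i \in U -> j \notin U -> A i j * w j 0 < w i 0) ->
     U = setT) ->
  efficient A w.
Proof.
move=> A0 Arec w0 noU; split=> // -[w' [w'0 le_dom [i0 [j0]]]].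
pose ratio i := w' i 0 / w i 0.
have [k _ kmin] := @arg_minP _ _ _ i0 xpredT ratio isT.
pose U := [set i | ratio i == ratio k].
have UT : U = setT.
  apply: noU => [|i j]; first by apply/set0Pn; exists k; rewrite inE.
  rewrite !inE => /eqP ri rj.
  have lt_ij : ratio i < ratio j by rewrite ri lt_neqAle eq_sym rj kmin.
  (* If w_i / w_j <= a_ij, then a_ji <= w_j / w_i < w'_j / w'_i, so w' is strictly worse than w at
     (j, i). *)
  rewrite ltNge; apply/negP => wij.
  have Aji : A j i <= w j 0 / w i 0.
    rewrite Arec ler_pdivlMr // mulrC ler_pdivrMr // mulrC //.
  have {}lt_ij : w j 0 / w i 0 < w' j 0 / w' i 0.
    move: lt_ij; rewrite /ratio ltr_pdivrMr // mulrAC ltr_pdivlMr // => h.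
    rewrite ltr_pdivrMr // mulrAC ltr_pdivlMr //.
    by rewrite mulrC [ltRHS]mulrC in h *; lra.
  have := le_dom j i.
  by rewrite ler0_norm ?ler0_norm; lra.
have ratioE i : w' i 0 = ratio k * w i 0.
  have : i \in U by rewrite UT.
  by rewrite inE => /eqP <-; rewrite divfK // gt_eqF.
have rk0 : ratio k != 0 by rewrite gt_eqF ?divr_gt0.
by rewrite !ratioE -mulf_div divff // mul1r ltxx.
Qed.

(** Put f_ij = a_ij w_j / w_i. Each row of f sums to r, and f_ij f_ji = 1 gives f_ij + f_ji >= 2;
    summing over all (i, j) gives 2 r n >= 2 n^2. *)
Lemma le_dim_eigenvalue (R : realFieldType) (n : nat) (A : 'M[R]_n)
    (w : 'cV[R]_n) (r : R) :
  (forall i j, 0 < A i j) -> (forall i j, A j i = (A i j)^-1) ->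
  (forall i, 0 < w i 0) -> (0 < n)%N -> A *m w = r *: w -> n%:R <= r.
Proof.
move=> A0 Arec w0 n0 Aw.
pose f i j := A i j * w j 0 / w i 0.
have fsum : \sum_i \sum_j f i j = r * n%:R.
  rewrite (eq_bigr (fun=> r)) => [|i _].
    by rewrite sumr_const card_ord mulr_natr.
  rewrite -mulr_suml; have := congr1 (fun B : 'cV_n => B i 0) Aw.
  by rewrite !mxE => ->; rewrite mulfK // gt_eqF.
have fge2 i j : 2 <= f i j + f j i.
  have f0 : 0 < f i j by rewrite !mulr_gt0 ?invr_gt0.
  have -> : f j i = (f i j)^-1.
    by rewrite /f Arec !invfM invrK mulrAC.
  rewrite -subr_ge0.
  have -> : f i j + (f i j)^-1 - 2 = (f i j - 1) ^+ 2 / f i j.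
    by field; rewrite gt_eqF.
  by rewrite divr_ge0 ?sqr_ge0 // ltW.
have fsum2 : \sum_i \sum_j (f i j + f j i) = r * n%:R + r * n%:R.
  under eq_bigr do rewrite big_split.
  by rewrite big_split /= [X in _ + X]exchange_big fsum.
have : \sum_(i < n) \sum_(j < n) 2 <= \sum_i \sum_j (f i j + f j i).
  by apply: ler_sum => i _; apply: ler_sum => j _.
rewrite fsum2 !sumr_const !card_ord -[_ *+ n *+ n]mulr_natr -mulr_natr.
by rewrite -mulrDl ler_pM2r ?ltr0n // => ?; lra.
Qed.

(* If no member of [U] beat [i], row [i] would give [r < n]. *)
Lemma source_beaten (R : realFieldType) (n : nat) (A : 'M[R]_n)
    (w : 'cV[R]_n) (r : R) (U : {set 'I_n}) (i : 'I_n) :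
  (forall i j, 0 < A i j) -> (forall i j, A j i = (A i j)^-1) ->
  (forall i, 0 < w i 0) -> A *m w = r *: w ->
  (forall i j, i \in U -> j \notin U -> A i j * w j 0 < w i 0) ->
  U != setT -> i \in U -> exists2 j, j \in U & w i 0 < A i j * w j 0.
Proof.
move=> A0 Arec w0 Aw cut UT iU; apply/exists_inP.
apply: contraT; rewrite negb_exists_in => /forall_inP le_i.
have {}le_i j : A i j * w j 0 <= w i 0.
  by have [/le_i|/(cut _ _ iU)/ltW //] := boolP (j \in U); rewrite -leNgt.
have [j jU] : exists j, j \notin U.
  apply/existsP; apply: contraNT UT; rewrite negb_exists => /forallP h.
  by apply/eqP/setP => j; rewrite inE; apply: negbNE.
have n0 : (0 < n)%N by apply: leq_ltn_trans (ltn_ord i).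
have := le_dim_eigenvalue A0 Arec w0 n0 Aw.
rewrite leNgt => /negP; case.
rewrite -(ltr_pM2r (w0 i)); have := congr1 (fun B : 'cV_n => B i 0) Aw.
rewrite !mxE => <-.
have -> : n%:R * w i 0 = \sum_(k < n) w i 0.
  by rewrite sumr_const card_ord mulr_natl.
(* The term of the outside index j is strictly smaller, so row i sums to less than n w_i. *)
rewrite (bigD1 j) // [ltRHS](bigD1 j) //=.
by apply: ltr_leD; [exact: cut | apply: ler_sum].
Qed.

(** * Entries and row sums of [Zmx] *)

Lemma Zmx_gt0 (R : realType) (n : nat) (x y z a : R) :
  0 < x -> 0 < y -> 0 < z -> 0 < a -> forall i j, 0 < Zmx n x y z a i j.
Proof.
move=> x0 y0 z0 a0 i j; rewrite mxE.
by do 8?[case: ifP => _ //]; rewrite invr_gt0.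
Qed.

Lemma Zmx_reciprocal (R : realType) (n : nat) (x y z a : R) (i j : 'I_n) :
  (5 <= n)%N -> Zmx n x y z a j i = (Zmx n x y z a i j)^-1.
Proof.
move=> n5; rewrite !mxE !xpair_eqE.
(* As n >= 5, the indices 1, 2, n-1, n are distinct. *)
have atmost1 (k : 'I_n) :
    (((k.+1 == 1) + (k.+1 == 2) + (k.+1 == n - 1) + (k.+1 == n)) <= 1)%N by lia.
move: (atmost1 i) (atmost1 j).
case: (i.+1 == 1)%N (i.+1 == 2)%N (i.+1 == n - 1)%N (i.+1 == n)%N =>
  [] [] [] [] //= _;
case: (j.+1 == 1)%N (j.+1 == 2)%N (j.+1 == n - 1)%N (j.+1 == n)%N =>
  [] [] [] [] //= _; by rewrite ?invrK ?invr1.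
Qed.

(** Rows 1, 2, n-1 and n of [Zmx] differ from the all-ones row in at most two columns, so their
    products with w are the total weight plus two corrections. *)
Lemma sum_eq_but_two (V : zmodType) (n : nat) (F G : 'I_n -> V) (p q : 'I_n) :
  p != q -> (forall j, j != p -> j != q -> F j = G j) ->
  \sum_j F j = \sum_j G j + ((F p - G p) + (F q - G q)).
Proof.
move=> pq FG; apply/eqP; rewrite addrC -subr_eq -sumrB; apply/eqP.
rewrite (bigD1 p) // (bigD1 q) 1?eq_sym //= big1 ?addr0 // => j /andP[jp jq].
by rewrite FG ?subrr.
Qed.

(** * Reduction of the theorem to the five classes *)

Theorem theorem7 (R : realType) (n : nat) (x y z a : R) (w : 'cV[R]_n)
    (hn : (5 <= n)%N) (hx : 0 < x) (hy : 0 < y) (hz : 0 < z) (ha : 0 < a)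
    (hmin : x <= Num.min a (Num.min y z))
    (hi : ~ (x < z < a /\ a < y /\ z < 1))
    (hii : ~ (x < y < a /\ a < z /\ 1 < a))
    (hiii : ~ (x <= a /\ a < 1 < Num.min y z))
    (hw : is_perron_eigenvector (Zmx n x y z a) w) :
  efficient (Zmx n x y z a) w.
Proof.
move: hmin; rewrite !le_min => /and3P[xa xy xz].
case: hw => w0 [r _ Aw] _.
case: n hn => [|[|[|[|[|m]]]]] // hn in w w0 Aw *.
set A := Zmx _ _ _ _ _ in Aw *.
have A0 : forall i j, 0 < A i j by exact: Zmx_gt0.
have Arec : forall i j, A j i = (A i j)^-1.
  by move=> i j; exact: Zmx_reciprocal.
apply: efficient_of_no_source => // U U0 cut.
apply/eqP; apply: contraT => UT.
(* Here n = m + 5, and the 0-based 0, 1, m + 3, m + 4 are the indices 1, 2, n-1, n. The 0-based 2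
   represents the middle. *)
pose i1 : 'I_m.+4.+1 := @Ordinal m.+4.+1 0 isT.
pose i2 : 'I_m.+4.+1 := @Ordinal m.+4.+1 1 isT.
pose k : 'I_m.+4.+1 := @Ordinal m.+4.+1 2 isT.
have p_lt : (m.+3 < m.+4.+1)%N by [].
have q_lt : (m.+4 < m.+4.+1)%N by [].
pose p : 'I_m.+4.+1 := Ordinal p_lt.
pose q : 'I_m.+4.+1 := Ordinal q_lt.
pose mid j := [&& j != i1, j != i2, j != p & j != q].
have mS : (m == m.+1) = false by rewrite ltn_eqF.
have Sm : (m.+1 == m) = false by rewrite gtn_eqF.
have midk : mid k by rewrite /mid -!val_eqE.
have pq : p != q by rewrite -val_eqE /= !eqSS mS.
have qp : q != p by rewrite eq_sym.
have mid_col i j : mid j -> A i j = 1.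
  rewrite /mid -!val_eqE /= =>
    /and4P[/negbTE j1 /negbTE j2 /negbTE jp /negbTE jq].
  by rewrite mxE !xpair_eqE subn1 !eqSS j1 j2 jp jq !andbF.
have mid_row i j : mid i -> A i j = 1.
  by move=> /mid_col h; rewrite -[A i j]invrK -Arec h invr1.
have Aii i : A i i = 1.
  rewrite mxE !xpair_eqE subn1 !eqSS /=.
  by do 8?[case: ifP => [/andP[/eqP-> //]|_]].
have [A12 A1p A1q] : [/\ A i1 i2 = 1, A i1 p = y & A i1 q = x].
  by split; rewrite mxE !xpair_eqE !subn1 /= ?eqSS ?eqxx ?mS ?Sm.
have [A2p A2q Apq] : [/\ A i2 p = a, A i2 q = z & A p q = 1].
  by split; rewrite mxE !xpair_eqE !subn1 /= ?eqSS ?eqxx ?mS ?Sm.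
have A21 : A i2 i1 = 1 by rewrite Arec A12 invr1.
have Aqp : A q p = 1 by rewrite Arec Apq invr1.
have [Ap1 Aq1] : A p i1 = y^-1 /\ A q i1 = x^-1 by rewrite !(Arec i1) A1p A1q.
have [Ap2 Aq2] : A p i2 = a^-1 /\ A q i2 = z^-1 by rewrite !(Arec i2) A2p A2q.
have split5 j : [\/ j = i1, j = i2, j = p | j = q] \/ mid j.
  rewrite /mid; case: eqVneq => [->|_]; first by left; constructor 1.
  case: eqVneq => [->|_]; first by left; constructor 2.
  case: eqVneq => [->|_]; first by left; constructor 3.
  by case: eqVneq => [->|_]; [left; constructor 4 | right].
set u := w i1 0; set v := w i2 0; set c := w k 0.
set s := w p 0; set t := w q 0.
pose S := \sum_j w j 0.
have rowE i : r * w i 0 = \sum_j A i j * w j 0.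
  by have := congr1 (fun B : 'cV_m.+4.+1 => B i 0) Aw; rewrite !mxE => <-.
have row_left i : i = i1 \/ i = i2 ->
    r * w i 0 = S + ((A i p * s - s) + (A i q * t - t)).
  move=> ii; rewrite rowE; apply: sum_eq_but_two => // j jp jq.
  have [|/mid_col->] := split5 j; last by rewrite mul1r.
  by case=> jE; move: jp jq; rewrite jE ?eqxx // => _ _;
    case: ii => ->; rewrite ?Aii ?A12 ?A21 mul1r.
have row_right i : i = p \/ i = q ->
    r * w i 0 = S + ((A i i1 * u - u) + (A i i2 * v - v)).
  move=> ii; rewrite rowE; apply: sum_eq_but_two => // j jp jq.
  have [|/mid_col->] := split5 j; last by rewrite mul1r.
  by case=> jE; move: jp jq; rewrite jE ?eqxx // => _ _;
    case: ii => ->; rewrite ?Aii ?Apq ?Aqp mul1r.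
have row_mid j : mid j -> r * w j 0 = S.
  by move=> jmid; rewrite rowE; apply: eq_bigr => l _; rewrite mid_row // mul1r.
have S0 : 0 < S.
  by rewrite /S (bigD1 i1) //= ltr_wpDr ?sumr_ge0 // => j _; exact: ltW.
have r0 : 0 < r by have := S0; rewrite -(row_mid k) // pmulr_lgt0.
have w_mid j : mid j -> w j 0 = c.
  by move=> jmid; apply: (mulfI (lt0r_neq0 r0)); rewrite !row_mid.
pose M := \sum_(j | mid j) w j 0.
have M0 : 0 < M.
  by rewrite /M (bigD1 k) //= ltr_wpDr ?sumr_ge0 // => j _; exact: ltW.
have SE : S = u + v + s + t + M.
  rewrite /S (bigD1 i1) // (bigD1 i2) // (bigD1 p) // (bigD1 q) ?qp //=.
  rewrite -!addrA; do 4!congr (_ + _).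
  by apply: eq_bigl => j; rewrite /mid !andbA.
have sys : Zsystem x y z a u v c s t M r.
  have R1 : r * u = _ := row_left i1 (or_introl erefl).
  have R2 : r * v = _ := row_left i2 (or_intror erefl).
  have Rp : r * s = _ := row_right p (or_introl erefl).
  have Rq : r * t = _ := row_right q (or_intror erefl).
  have Rk : r * c = _ := row_mid k midk.
  rewrite A1p A1q A2p A2q Ap1 Ap2 Aq1 Aq2 in R1 R2 Rp Rq.
  by split=> //; rewrite ?w0 //; lra.
(* Two middle indices have equal weights and matrix entry 1, so neither beats the other and [U]
   cannot separate them. *)
have mid_mem j : mid j -> (j \in U) = (k \in U).
  move=> jmid; apply/idP/idP => h; apply: contraT => /(cut _ _ h).
  - by rewrite mid_row // mul1r [w j 0]w_mid // ltxx.
  - by rewrite mid_row // mul1r [w j 0]w_mid // ltxx.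
have sep i j : (i \in U) (+) (j \in U) ->
    if i \in U then A i j * w j 0 < w i 0 else A j i * w i 0 < w j 0.
  by case: ifPn => iU /=; [move=> /cut->| move=> /cut->].
have beaten i : i \in U ->
    [|| (i1 \in U) && (w i 0 < A i i1 * u), (i2 \in U) && (w i 0 < A i i2 * v),
        (k \in U) && (w i 0 < c), (p \in U) && (w i 0 < A i p * s)
      | (q \in U) && (w i 0 < A i q * t)].
  move=> iU; have [j jU] := source_beaten A0 Arec w0 Aw cut UT iU.
  have [[jE|jE|jE|jE]|jmid] := split5 j.
  - by rewrite jE in jU * => ->; rewrite jU.
  - by rewrite jE in jU * => ->; rewrite jU !orbT.
  - by rewrite jE in jU * => ->; rewrite jU !orbT.
  - by rewrite jE in jU * => ->; rewrite jU !orbT.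
  - rewrite (mid_col i j) // mul1r [w j 0]w_mid // -(mid_mem j) // jU => ->.
    by rewrite !orbT.
have src : Zsource x y z a u v c s t (i1 \in U) (i2 \in U) (k \in U) (p \in U)
    (q \in U).
  split.
  - by move/sep; rewrite A12 A21 !mul1r.
  - by move/sep; rewrite mid_col // mid_row // !mul1r.
  - by move/sep; rewrite mid_col // mid_row // !mul1r.
  - by move/sep; rewrite mid_col // mid_row // !mul1r.
  - by move/sep; rewrite mid_col // mid_row // !mul1r.
  - by move/sep; rewrite Apq Aqp !mul1r.
  - by move/sep; rewrite A1p Ap1 gtr_mulVl.
  - by move/sep; rewrite A1q Aq1 gtr_mulVl.
  - by move/sep; rewrite A2p Ap2 gtr_mulVl.
  - by move/sep; rewrite A2q Aq2 gtr_mulVl.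
  - by move/beaten; rewrite Aii A12 A1p A1q !mul1r ltxx andbF.
  - by move/beaten; rewrite Aii A21 A2p A2q !mul1r ltxx andbF.
  - by move/beaten; rewrite !(mid_row k) // !mul1r ltxx andbF.
  - by move/beaten; rewrite Aii Ap1 Ap2 Apq !mul1r ltxx andbF !ltr_mulVl.
  - by move/beaten; rewrite Aii Aq1 Aq2 Aqp !mul1r ltxx andbF orbF !ltr_mulVl.
have [j jU] := set0Pn _ U0.
have /(source_full xa xy xz hi hii hiii sys src)/and5P[U1 U2 Uk Up Uq] :
    [|| i1 \in U, i2 \in U, k \in U, p \in U | q \in U].
  have [[jE|jE|jE|jE]|/mid_mem jk] := split5 j.
  - by rewrite -jE jU.
  - by rewrite -jE jU !orbT.
  - by rewrite -jE jU !orbT.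
  - by rewrite -jE jU !orbT.
  - by rewrite -jk jU !orbT.
case/eqP: UT; apply/setP => l; rewrite inE.
by have [[->|->|->|->]|/mid_mem->] := split5 l.
Qed.
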